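(* Let $V=\{1,\dots,N\}$ and let $F$ be a finite set of nonempty subsets of $V$ (hyperedges). Consider the factor graph model $p(x)=Z^{-1}\prod_{\lambda\in F}\psi_\lambda(x_\lambda)$ on $x\in\{\pm1\}^V$, with positive functions $\psi_\lambda$ and $Z=\sum_x\prod_\lambda\psi_\lambda(x_\lambda)$, and let $p_1$ be the marginal distribution of $x_1$ under $p$. Let a fixed point of loopy belief propagation be given, with beliefs $b_i,b_\lambda$, Bethe approximation $Z_B$, and quantities $\gamma_i$, $\beta^\lambda_I$ as defined in the context. Then \[ \frac{Z}{Z_B}\,\frac{p_1(+1)-p_1(-1)}{\sqrt{b_1(1)b_1(-1)}}=\sum_{s\subset E_H}(-1)^{|s|}\prod_{\lambda\in F}\beta^\lambda_{I_\lambda(s)}\prod_{i\in V\setminus\{1\}}f_{d_i(s)}(\gamma_i)\;g_{d_1(s)}(\gamma_1). \]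
   Context: $x_\lambda=(x_i)_{i\in\lambda}$. $G_H$ is the bipartite graph with vertex set $V\cup F$ and an edge $(i,\lambda)$ whenever $i\in\lambda$; $E_H$ is its edge set. For $s\subset E_H$, $d_i(s)$ is the number of edges of $s$ incident to $i\in V$, and $I_\lambda(s)=\{i\in\lambda:(i,\lambda)\in s\}$. $d_i$ is the number of $\lambda\in F$ containing $i$. The polynomials $f_n$ satisfy $f_0(x)=1$, $f_1(x)=0$, $f_{n+1}(x)=xf_n(x)+f_{n-1}(x)$; the polynomials $g_n$ satisfy $g_0(x)=x$, $g_1(x)=-2$, $g_{n+1}(x)=xg_n(x)+g_{n-1}(x)$. A fixed point of LBP consists of positive functions $\mu_{\lambda\to i}(x_i)$ and $\nu_{i\to\lambda}(x_i)$ for each pair $i\in\lambda\in F$ such that, for suitable positive constants, $\mu_{\lambda\to i}(x_i)\propto\sum_{x_{\lambda\setminus\{i\}}}\psi_\lambda(x_\lambda)\prod_{j\in\lambda,j\ne i}\nu_{j\to\lambda}(x_j)$ and $\nu_{i\to\lambda}(x_i)\propto\prod_{\mu\ni i,\mu\ne\lambda}\mu_{\mu\to i}(x_i)$. Beliefs: $b_i(x_i)\propto\prod_{\mu\ni i}\mu_{\mu\to i}(x_i)$ and $b_\lambda(x_\lambda)\propto\psi_\lambda(x_\lambda)\prod_{j\in\lambda}\nu_{j\to\lambda}(x_j)$, each normalized to sum to $1$. The Bethe approximation: $\log Z_B=\sum_{\lambda}\sum_{x_\lambda}b_\lambda\log\psi_\lambda-\sum_\lambda\sum_{x_\lambda}b_\lambda\log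 b_\lambda+\sum_{i\in V}(d_i-1)\sum_{x_i}b_i\log b_i$. Let $\xi_i=\sqrt{b_i(1)/b_i(-1)}$, so $b_i(x_i)=\xi_i^{x_i}/(\xi_i+\xi_i^{-1})$, and $\gamma_i=\frac{b_i(1)-b_i(-1)}{\sqrt{b_i(1)b_i(-1)}}=\xi_i-\xi_i^{-1}$. For $\lambda\in F$ and $I\subset\lambda$, the numbers $\beta^\lambda_I$ are defined by $\beta^\lambda_\emptyset=1$, $\beta^\lambda_I=0$ if $|I|=1$, and, for $|I|\ge2$, as the (unique) real numbers such that $b_\lambda(x_\lambda)=\frac{1}{\prod_{i\in\lambda}(\xi_i+\xi_i^{-1})}\sum_{I\subset\lambda}\beta^\lambda_I\prod_{i\in I}x_i\prod_{j\in\lambda\setminus I}\xi_j^{x_j}$ for all $x_\lambda$. *)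

(* Defs.v *)
From mathcomp Require Import all_boot all_order all_algebra.
From mathcomp Require Import all_classical all_reals all_analysis.

Set Implicit Arguments.
Unset Strict Implicit.
Unset Printing Implicit Defensive.

Import Order.TTheory GRing.Theory Num.Theory.
Local Open Scope ring_scope.

(* The spin values +1 and -1 are encoded as true and false. *)
Definition spin (a : bool) : int := if a then 1 else -1.

Section Polynomials.
Variable R : nzRingType.

Fixpoint fpoly (n : nat) : {poly R} :=
  match n with
  | 0 => 1
  | m.+1 => match m with 0 => 0 | k.+1 => 'X * fpoly m + fpoly k end
  end.

Fixpoint gpoly (n : nat) : {poly R} :=
  match n with
  | 0 => 'X
  | m.+1 => match m with 0 => (- 2%:R)%:P | k.+1 => 'X * gpoly m + gpoly k end
  end.

End Polynomials.

(* Local configurations x_l, i.e. the elements of {+1,-1}^l. *)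
Notation lconf l := {ffun {i | i \in l} -> bool}.

Definition restrict (V : finType) (l : {set V}) (x : {ffun V -> bool}) :
  lconf l := [ffun i => x (val i)].

Section FactorGraph.
Variables (R : realType) (V : finType) (F : {set {set V}}).
Variable psi : forall l : {set V}, lconf l -> R.

Definition weight (x : {ffun V -> bool}) : R :=
  \prod_(l in F) psi (restrict l x).

Definition partition_function : R := \sum_(x : {ffun V -> bool}) weight x.

Definition prob (x : {ffun V -> bool}) : R := weight x / partition_function.

Definition marginal (i : V) (a : bool) : R :=
  \sum_(x : {ffun V -> bool} | x i == a) prob x.

Definition degree (i : V) : nat := #|[set l in F | i \in l]|.

Definition edges : {set V * {set V}} :=
  [set e | (e.2 \in F) && (e.1 \in e.2)].

Definition sub_degree (s : {set V * {set V}}) (i : V) : nat :=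
  #|[set e in s | e.1 == i]|.

Definition sub_factor (s : {set V * {set V}}) (l : {set V}) : {set V} :=
  [set i in l | (i, l) \in s].

(* mu l i is the message from the factor l to the vertex i, nu i l the message
   from i to l; only the values at incident pairs are ever used. *)
Variables (mu : {set V} -> V -> bool -> R) (nu : V -> {set V} -> bool -> R).

Definition lbp_fixed_point : Prop :=
  [/\ forall (l : {set V}) i a, l \in F -> i \in l -> 0 < mu l i a /\ 0 < nu i l a,
      forall (l : {set V}) (i : {i : V | i \in l}), l \in F ->
        exists2 c : R, 0 < c & forall a, mu l (val i) a =
          c * \sum_(y : lconf l | y i == a)
                psi y * \prod_(j : {j : V | j \in l} | j != i)
                          nu (val j) l (y j)
    & forall (l : {set V}) i, l \in F -> i \in l ->
        exists2 c : R, 0 < c & forall a, nu i l a =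
          c * \prod_(m in F | (i \in m) && (m != l)) mu m i a].

Definition vbelief_unnorm (i : V) (a : bool) : R :=
  \prod_(m in F | i \in m) mu m i a.

Definition vbelief (i : V) (a : bool) : R :=
  vbelief_unnorm i a / \sum_(c : bool) vbelief_unnorm i c.

Definition fbelief_unnorm (l : {set V}) (y : lconf l) : R :=
  psi y * \prod_(j : {j : V | j \in l}) nu (val j) l (y j).

Definition fbelief (l : {set V}) (y : lconf l) : R :=
  fbelief_unnorm y / \sum_(z : lconf l) fbelief_unnorm z.

Definition log_bethe : R :=
  \sum_(l in F) \sum_(y : lconf l) fbelief y * ln (psi y)
  - \sum_(l in F) \sum_(y : lconf l) fbelief y * ln (fbelief y)
  + \sum_(i : V) ((degree i)%:R - 1)
                 * \sum_(a : bool) vbelief i a * ln (vbelief i a).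

Definition bethe : R := expR log_bethe.

Definition xi (i : V) : R := Num.sqrt (vbelief i true / vbelief i false).

Definition gamma (i : V) : R :=
  (vbelief i true - vbelief i false)
  / Num.sqrt (vbelief i true * vbelief i false).

(* The last clause only fixes the value at index sets not contained in l, which
   carry no meaning, so that the family is determined uniquely. *)
Definition is_beta (l : {set V}) (B : {ffun {set V} -> R}) : Prop :=
  [/\ B finset.set0 = 1,
      forall I : {set V}, I \subset l -> #|I| = 1%N -> B I = 0,
      forall y : lconf l, fbelief y =
        (\prod_(i in l) (xi i + (xi i)^-1))^-1 *
        \sum_(I : {set V} | I \subset l)
           B I * \prod_(i : {i : V | i \in l} | val i \in I) (spin (y i))%:~R
               * \prod_(j : {j : V | j \in l} | val j \notin I)
                    xi (val j) ^ spin (y j)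
    & forall I : {set V}, ~~ (I \subset l) -> B I = 0].

(* The family beta^l is the unique one satisfying is_beta l; the default value 0
   is only taken if there is none, which does not happen at a fixed point. *)
Definition beta (l : {set V}) : {ffun {set V} -> R} :=
  xget [ffun=> 0] [set B | is_beta l B]%classic.

End FactorGraph.

(* Main.v *)
(** Write [xi_i = sqrt (b_i(1) / b_i(-1))] and [t_i(a) = a * xi_i ^ (- a)].  At a
    fixed point the beliefs are a reparametrization of the model: up to the
    constant [Z_B], the weight of [x] is [prod_l b_l(x_l) * prod_i b_i(x_i) ^ (1 - d_i)].
    The definition of [beta] says that [b_l(x_l)] is [prod_{i in l} b_i(x_i)]
    times [sum_{I subset l} beta_I prod_{i in I} t_i(x_i)], so the powers of the
    [b_i] cancel and the weight of [x] is [Z_B * prod_i b_i(x_i)] times a product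
    over factors.  Expanding this product over choices of [I_l], that is over
    subsets [s] of edges, and summing over [x] leaves at each vertex the
    [d_i(s)]-th moment of [t_i] under [b_i].  Both values of [t_i] are roots of
    [T ^ 2 + gamma_i T - 1], hence these moments are [(-1) ^ n f_n(gamma_i)];
    the additional factor [x_1] turns [f_n] into [g_n] at the marked vertex. *)

Require Import Defs.
From mathcomp Require Import all_boot all_order all_algebra.
From mathcomp Require Import all_classical all_reals all_analysis.
From mathcomp Require Import ring.

Set Implicit Arguments.
Unset Strict Implicit.
Unset Printing Implicit Defensive.

Import Order.TTheory GRing.Theory Num.Theory.
Local Open Scope ring_scope.

(** * Logarithms of products and expansion over subsets *)

Lemma ln_prod (R : realType) (I : Type) (r : seq I) (P : pred I) (E : I -> R) :
  (forall i, P i -> 0 < E i) ->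
  ln (\prod_(i <- r | P i) E i) = \sum_(i <- r | P i) ln (E i).
Proof.
move=> E_gt0; suff [] : 0 < \prod_(i <- r | P i) E i /\
    ln (\prod_(i <- r | P i) E i) = \sum_(i <- r | P i) ln (E i) by [].
elim/big_ind2: _ => [|x1 x2 y1 y2 [x_gt0 xE] [y_gt0 yE]|i /E_gt0 //].
  by rewrite ln1.
by rewrite mulr_gt0 // lnM // xE yE.
Qed.

Lemma prodrD_subsets (R : comNzRingType) (V : finType) (l : {set V})
    (A B : V -> R) :
  \prod_(i in l) (A i + B i) =
  \sum_(I : {set V} | I \subset l)
     \prod_(i in I) A i * \prod_(i in l :\: I) B i.
Proof.
(* Off [l] the two summands are 0 and 1, so in the expansion over all subsets of [V] those not
   contained in [l] drop out. *)
transitivity (\prod_i ((if i \in l then A i else 0) +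
                       (if i \in l then B i else 1))).
  by rewrite big_mkcond; apply: eq_bigr => i _; case: ifP => // _; rewrite add0r.
rewrite bigA_distr [RHS]big_mkcond; apply: eq_bigr => I _.
case: ifPn => [/fintype.subsetP Il | /subsetPn[i iI il]]; last first.
  by rewrite (bigD1 i) //= iI (negPf il) mul0r.
rewrite (bigID (mem I)) /=; congr (_ * _).
  by apply: eq_bigr => i iI; rewrite iI Il.
rewrite [RHS]big_mkcond [LHS]big_mkcond; apply: eq_bigr => i _.
by rewrite inE; case: (i \in I).
Qed.

Lemma fpolySS (R : nzRingType) n : fpoly R n.+2 = 'X * fpoly R n.+1 + fpoly R n.
Proof. by []. Qed.

Lemma gpolySS (R : nzRingType) n : gpoly R n.+2 = 'X * gpoly R n.+1 + gpoly R n.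
Proof. by []. Qed.

(** * Moments of the tilted spin *)

Definition tilt (R : realType) (x : R) (a : bool) : R :=
  (spin a)%:~R * x ^ (- spin a).

Section SpinPolynomials.
Variables (R : realType) (x : R).
Hypothesis x_gt0 : 0 < x.

Let tilt_true : tilt x true = x^-1.
Proof. by rewrite /tilt /= mul1r exprN1. Qed.

Let tilt_false : tilt x false = - x.
Proof. by rewrite /tilt /= opprK expr1z mulN1r. Qed.

(** The two values [x^-1] and [- x] have sum [- (x - x^-1)] and product -1, which determines their
    quadratic equation. *)
Lemma tilt_expSS a n :
  tilt x a ^+ n.+2 = - (x - x^-1) * tilt x a ^+ n.+1 + tilt x a ^+ n.
Proof.
by rewrite !exprS; case: a; rewrite ?tilt_true ?tilt_false; field; rewrite gt_eqF.
Qed.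

Lemma tilt_moment_f n :
  \sum_(a : bool) x ^ spin a / (x + x^-1) * tilt x a ^+ n =
  (-1) ^+ n * (fpoly R n).[x - x^-1].
Proof.
(* The recursion reaches back two steps, so the induction carries [n] and [n.+1] together; the sign
   [(-1) ^+ n] absorbs the minus in [- (x - x^-1)]. *)
have [] // : (fun n => \sum_(a : bool) x ^ spin a / (x + x^-1) * tilt x a ^+ n =
    (-1) ^+ n * (fpoly R n).[x - x^-1]) n /\
  (fun n => \sum_(a : bool) x ^ spin a / (x + x^-1) * tilt x a ^+ n =
    (-1) ^+ n * (fpoly R n).[x - x^-1]) n.+1.
elim: n => [|n [IH1 IH2]]; split => //.
- rewrite big_bool /= !expr0 exprN1 expr1z !hornerE; field.
  by rewrite gt_eqF //= -?expr2 gt_eqF // addr_gt0 // exprn_gt0.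
- rewrite big_bool /= !expr1 tilt_true tilt_false exprN1 expr1z !hornerE.
  field.
  by rewrite gt_eqF //= -?expr2 gt_eqF // addr_gt0 // exprn_gt0.
transitivity (- (x - x^-1) *
    (\sum_(a : bool) x ^ spin a / (x + x^-1) * tilt x a ^+ n.+1) +
    \sum_(a : bool) x ^ spin a / (x + x^-1) * tilt x a ^+ n).
  rewrite mulr_sumr -big_split /=; apply: eq_bigr => a _.
  by rewrite tilt_expSS; ring.
rewrite IH1 IH2 fpolySS hornerD hornerM hornerX !exprS; ring.
Qed.

(** The recursion is that of [tilt_moment_f], started from [x - x^-1] and 2. The weights are not
    divided by [x + x^-1], since the square root in the theorem cancels this normalization at the
    marked vertex. *)
Lemma tilt_moment_g n :
  \sum_(a : bool) (spin a)%:~R * x ^ spin a * tilt x a ^+ n =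
  (-1) ^+ n * (gpoly R n).[x - x^-1].
Proof.
have [] // : (fun n => \sum_(a : bool) (spin a)%:~R * x ^ spin a * tilt x a ^+ n =
    (-1) ^+ n * (gpoly R n).[x - x^-1]) n /\
  (fun n => \sum_(a : bool) (spin a)%:~R * x ^ spin a * tilt x a ^+ n =
    (-1) ^+ n * (gpoly R n).[x - x^-1]) n.+1.
elim: n => [|n [IH1 IH2]]; split => //.
- by rewrite big_bool /= !expr0 exprN1 expr1z !hornerE; ring.
- rewrite big_bool /= !expr1 tilt_true tilt_false exprN1 expr1z !hornerE.
  by field; rewrite gt_eqF.
transitivity (- (x - x^-1) *
    (\sum_(a : bool) (spin a)%:~R * x ^ spin a * tilt x a ^+ n.+1) +
    \sum_(a : bool) (spin a)%:~R * x ^ spin a * tilt x a ^+ n).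
  rewrite mulr_sumr -big_split /=; apply: eq_bigr => a _.
  by rewrite tilt_expSS; ring.
rewrite IH1 IH2 gpolySS hornerD hornerM hornerX !exprS; ring.
Qed.

(** This duality between the pair [spin a], [x ^ spin a] and the pair [tilt x c], 1 inverts the
    expansion that defines [beta]. *)
Lemma tilt_orthogonal a c :
  (spin a)%:~R * tilt x c + x ^ spin a =
  if a == c then x + x^-1 else 0.
Proof.
by case: a c => [] []; rewrite ?tilt_true ?tilt_false /= ?exprN1 ?expr1z; ring.
Qed.

Lemma tilt_mul_exp a : x ^ spin a * tilt x a = (spin a)%:~R.
Proof.
by case: a; rewrite ?tilt_true ?tilt_false /= ?exprN1 ?expr1z; field;
   rewrite gt_eqF.
Qed.

End SpinPolynomials.

(** * Two-point laws in terms of the square root of the odds *)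

Section TwoPointLaw.
Variables (R : realType) (p q : R).
Hypotheses (p_gt0 : 0 < p) (q_gt0 : 0 < q) (pq1 : p + q = 1).
Let x := Num.sqrt (p / q).

Let x_gt0 : 0 < x. Proof. by rewrite sqrtr_gt0 divr_gt0. Qed.

Let pE : p = q * x ^+ 2.
Proof. by rewrite sqr_sqrtr ?divr_ge0 ?ltW // mulrC divfK ?gt_eqF. Qed.

Let qE : q * (1 + x ^+ 2) = 1.
Proof. by rewrite mulrDr mulr1 -pE addrC. Qed.

Let x2_neq0 : 1 + x ^+ 2 != 0.
Proof. by rewrite gt_eqF // addr_gt0 // exprn_gt0. Qed.

Let qE' : q = (1 + x ^+ 2)^-1.
Proof. by rewrite -[LHS](mulfK x2_neq0) qE mul1r. Qed.

(** Since [p = q * x ^+ 2] and [q = (1 + x ^+ 2)^-1], the root is [q * x]. *)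
Lemma sqrt_two_point : Num.sqrt (p * q) = (x + x^-1)^-1.
Proof.
have -> : p * q = (q * x) ^+ 2 by rewrite [p in LHS]pE; ring.
rewrite sqrtr_sqr gtr0_norm ?mulr_gt0 // qE'; field.
by rewrite [x * x + 1]addrC -expr2 !x2_neq0 gt_eqF.
Qed.

Lemma two_point_true : p = x / (x + x^-1).
Proof.
rewrite [LHS]pE qE'; field.
by rewrite [x * x + 1]addrC -expr2 !x2_neq0 gt_eqF.
Qed.

Lemma two_point_false : q = x^-1 / (x + x^-1).
Proof.
rewrite [LHS]qE'; field.
by rewrite [x * x + 1]addrC -expr2 !x2_neq0 gt_eqF.
Qed.

Lemma two_point_gamma : (p - q) / Num.sqrt (p * q) = x - x^-1.
Proof.
rewrite sqrt_two_point invrK {1}two_point_true {1}two_point_false; field.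
by rewrite [x * x + 1]addrC -expr2 !x2_neq0 gt_eqF.
Qed.

End TwoPointLaw.

(** * Products over factors as sums over edge sets *)

Section SubgraphSums.
Variables (R : comNzRingType) (V : finType) (F : {set {set V}}).

(** Both sides are the product of [t e.1] over the edges [e] in [s], grouped by factor on the left
    and by vertex on the right. *)
Lemma prod_sub_factor (s : {set V * {set V}}) (t : V -> R) :
  s \subset edges F ->
  \prod_(l in F) \prod_(i in sub_factor s l) t i =
  \prod_i t i ^+ sub_degree s i.
Proof.
move=> /fintype.subsetP sE; transitivity (\prod_(e in s) t e.1).
  rewrite [RHS](partition_big snd [in F]) /=; last first.
    by move=> e /sE; rewrite inE => /andP[].
  apply: eq_bigr => l lF.
  rewrite [RHS](reindex_onto (fun i => (i, l)) fst) /=; last first.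
    by case=> i m /andP[_ /eqP <-].
  apply: eq_bigl => i; rewrite !inE !eqxx !andbT.
  by apply/andP/idP => [[]//|ils]; split=> //; have := sE _ ils; rewrite inE => /andP[].
rewrite (partition_big fst xpredT) //=; apply: eq_bigr => i _.
rewrite (eq_bigr (fun=> t i)); last by move=> e /andP[_ /eqP ->].
by rewrite prodr_const; congr (_ ^+ _); apply: eq_card => e; rewrite !inE.
Qed.

Lemma sum_sub_degree (s : {set V * {set V}}) : (\sum_i sub_degree s i = #|s|)%N.
Proof.
rewrite -sum1_card (partition_big fst xpredT) //=; apply: eq_bigr => i _.
by rewrite /sub_degree -sum1_card; apply: eq_bigl => e; rewrite inE.
Qed.

(** Choosing a subset of each [l] in [F] amounts to choosing the set of edges [(i, l)] with [i] in
    the subset chosen at [l]. *)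
Lemma prod_sum_subsets (B : {set V} -> {set V} -> R) :
  \prod_(l in F) \sum_(I : {set V} | I \subset l) B l I =
  \sum_(s : {set V * {set V}} | s \subset edges F)
     \prod_(l in F) B l (sub_factor s l).
Proof.
(* The default [set0] for choices outside [F] agrees with [sub_factor s l], which is empty there
   when [s] consists of edges. *)
rewrite (big_distr_big_dep finset.set0).
rewrite (reindex_onto (fun s : {set V * {set V}} => [ffun l => sub_factor s l])
  (fun f : {ffun {set V} -> {set V}} => [set e | e.1 \in f e.2])) /=; last first.
  move=> f /pfamilyP[/supportP fF fl]; apply/ffunP => l; rewrite ffunE.
  apply/setP => i; rewrite !inE /=.
  have [lF|lF] := boolP (l \in F); last by rewrite fF // inE andbF.
  by apply: andb_idl; apply: (fintype.subsetP (fl _ lF)).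
apply: eq_big => [s|s _]; last by apply: eq_bigr => l _; rewrite ffunE.
apply/andP/fintype.subsetP => [[/pfamilyP[/supportP sF _] /eqP sE] [i l] | sE].
  rewrite -sE inE /= => il; rewrite inE /=.
  have [lF|lF] := boolP (l \in F); last by move: il; rewrite sF // inE.
  by move: il; rewrite ffunE inE => /andP[].
split; last first.
  apply/eqP/setP => -[i l]; rewrite !inE ffunE inE /=.
  by apply: andb_idl => /sE; rewrite inE => /andP[].
apply/pfamilyP; split=> [|l lF].
  apply/supportP => l lF; rewrite ffunE; apply/setP => i; rewrite !inE.
  by apply/negP => /andP[_ /sE]; rewrite inE /= (negPf lF).
by rewrite ffunE; apply/fintype.subsetP => i; rewrite inE => /andP[].
Qed.

End SubgraphSums.

(** * Passing between local and global configurations *)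

Section LocalConfigurations.
Variables (V : finType) (l : {set V}).

(** The filler [false] is never evaluated below: [extend] only lets products over subsets of [l] be
    indexed by vertices of [V]. *)
Definition extend (y : lconf l) : {ffun V -> bool} :=
  [ffun i => if insub i is Some u then y u else false].

Lemma extendE (y : lconf l) u : extend y (val u) = y u.
Proof. by rewrite ffunE valK. Qed.

Lemma prod_local_split (R : comNzRingType) (I : {set V}) (y : lconf l)
    (w : {ffun V -> bool}) (A B : V -> bool -> R) :
  I \subset l -> (forall u, y u = w (val u)) ->
  \prod_(u : {i | i \in l} | val u \in I) A (val u) (y u)
  * \prod_(u : {i | i \in l} | val u \notin I) B (val u) (y u) =
  \prod_(i in I) A i (w i) * \prod_(i in l :\: I) B i (w i).
Proof.
move=> /fintype.subsetP Il yw; congr (_ * _).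
  rewrite (eq_bigr (fun u => A (val u) (w (val u)))); last by move=> u _; rewrite yw.
  rewrite -(big_sub_cond [in l] [in I] (fun i => A i (w i))) /=.
  by apply: eq_bigl => i; apply: andb_idl => /Il.
rewrite (eq_bigr (fun u => B (val u) (w (val u)))); last by move=> u _; rewrite yw.
rewrite -(big_sub_cond [in l] [predC I] (fun i => B i (w i))) /=.
by apply: eq_bigl => i; rewrite !inE andbC.
Qed.

End LocalConfigurations.

(** * Vertex beliefs at a fixed point *)

Section FixedPoint.
Variables (R : realType) (V : finType) (F : {set {set V}}).
Variable psi : forall l : {set V}, lconf l -> R.
Variables (mu : {set V} -> V -> bool -> R) (nu : V -> {set V} -> bool -> R).
Hypothesis psi_gt0 :
  forall l : {set V}, l \in F -> forall y : lconf l, 0 < psi y.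
Hypothesis fixed_pt : lbp_fixed_point F psi mu nu.

Local Notation b := (vbelief F mu).
Local Notation x := (xi F mu).
Local Notation bf := (fbelief psi nu).
Local Notation t i := (tilt (x i)).

Let mu_gt0 l i a : l \in F -> i \in l -> 0 < mu l i a.
Proof. by move=> lF il; have [/(_ l i a lF il)[]] := fixed_pt. Qed.

Let nu_gt0 l i a : l \in F -> i \in l -> 0 < nu i l a.
Proof. by move=> lF il; have [/(_ l i a lF il)[]] := fixed_pt. Qed.

Let vbelief_unnorm_gt0 i a : 0 < vbelief_unnorm F mu i a.
Proof. by apply: prodr_gt0 => l /andP[lF il]; apply: mu_gt0. Qed.

Let vnorm i : R := \sum_(a : bool) vbelief_unnorm F mu i a.

Let vnorm_gt0 i : 0 < vnorm i.
Proof. by rewrite /vnorm big_bool addr_gt0. Qed.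

Lemma vbelief_gt0 i a : 0 < b i a.
Proof. by rewrite divr_gt0 // vnorm_gt0. Qed.

Lemma sum_vbelief i : \sum_(a : bool) b i a = 1.
Proof. by rewrite -mulr_suml divff // gt_eqF // vnorm_gt0. Qed.

Let vbelief_true_false i : b i true + b i false = 1.
Proof. by rewrite -(sum_vbelief i) big_bool. Qed.

Lemma xi_gt0 i : 0 < x i.
Proof. by rewrite sqrtr_gt0 divr_gt0 // vbelief_gt0. Qed.

Lemma xiD_gt0 i : 0 < x i + (x i)^-1.
Proof. by rewrite addr_gt0 ?invr_gt0 // xi_gt0. Qed.

Lemma vbelief_xi i a : b i a = x i ^ spin a / (x i + (x i)^-1).
Proof.
case: a; rewrite /= ?exprN1 ?expr1z.
  by apply: two_point_true; rewrite ?vbelief_gt0 ?vbelief_true_false.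
by apply: two_point_false; rewrite ?vbelief_gt0 ?vbelief_true_false.
Qed.

Lemma gamma_xi i : gamma F mu i = x i - (x i)^-1.
Proof. by apply: two_point_gamma; rewrite ?vbelief_gt0 ?vbelief_true_false. Qed.

Lemma sqrt_vbelief i : Num.sqrt (b i true * b i false) = (x i + (x i)^-1)^-1.
Proof. by apply: sqrt_two_point; rewrite ?vbelief_gt0 ?vbelief_true_false. Qed.

(** * Local consistency of messages and beliefs *)

Let edge_const i l : R := b i true / (nu i l true * mu l i true).

(** By its update rule [nu i l] collects all messages into [i] except [mu l i], and multiplying by
    the latter restores the full product. The ratio is thus independent of the spin, so its value at
    [true] serves as the constant. *)
Lemma vbelief_edge i l a : l \in F -> i \in l ->
  b i a = edge_const i l * (nu i l a * mu l i a).
Proof.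
move=> lF il; have [_ _ /(_ l i lF il)[c c_gt0 nuE]] := fixed_pt.
have bE a' : b i a' = (c * vnorm i)^-1 * (nu i l a' * mu l i a').
  rewrite nuE /vbelief /vbelief_unnorm -/(vnorm i).
  rewrite [X in X / _](bigD1 l) ?lF //=.
  under eq_bigl do rewrite -andbA.
  by field; rewrite !gt_eqF.
rewrite /edge_const bE [in X in X / _]bE mulfK // gt_eqF // mulr_gt0 //.
  exact: nu_gt0.
exact: mu_gt0.
Qed.

Let edge_const_gt0 i l : l \in F -> i \in l -> 0 < edge_const i l.
Proof.
by move=> lF il; rewrite divr_gt0 ?vbelief_gt0 // mulr_gt0 ?nu_gt0 ?mu_gt0.
Qed.

Let fnorm (l : {set V}) : R := \sum_(y : lconf l) fbelief_unnorm psi nu y.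

Let fbelief_unnorm_gt0 (l : {set V}) (y : lconf l) : l \in F ->
  0 < fbelief_unnorm psi nu y.
Proof.
by move=> lF; rewrite mulr_gt0 ?psi_gt0 // prodr_gt0 // => j _; rewrite nu_gt0 ?(valP j).
Qed.

Let fnorm_gt0 l : l \in F -> 0 < fnorm l.
Proof.
move=> lF; rewrite /fnorm (bigD1 [ffun=> false]) //= ltr_pwDl ?fbelief_unnorm_gt0 //.
by apply: sumr_ge0 => y _; rewrite ltW // fbelief_unnorm_gt0.
Qed.

Let fbelief_gt0 (l : {set V}) (y : lconf l) : l \in F -> 0 < bf y.
Proof. by move=> lF; rewrite divr_gt0 ?fbelief_unnorm_gt0 // fnorm_gt0. Qed.

Let sum_fbelief (l : {set V}) : l \in F -> \sum_(y : lconf l) bf y = 1.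
Proof. by move=> lF; rewrite -mulr_suml divff // gt_eqF // fnorm_gt0. Qed.

(** Fixing the spin at [i] pulls out [nu i l a], and the remaining sum is the update of [mu l i];
    their product is proportional to [b i a] by [vbelief_edge]. *)
Lemma fbelief_marginal (l : {set V}) (i : {i | i \in l}) a : l \in F ->
  \sum_(y : lconf l | y i == a) bf y = b (val i) a.
Proof.
move=> lF; have il := valP i.
have [_ /(_ l i lF)[c c_gt0 muE] _] := fixed_pt.
pose C := (edge_const (val i) l * c)^-1.
have bE a' : \sum_(y : lconf l | y i == a') fbelief_unnorm psi nu y = C * b (val i) a'.
  rewrite (vbelief_edge a' lF il) muE.
  have -> : C * (edge_const (val i) l * (nu (val i) l a' * (c *
      \sum_(y : lconf l | y i == a') psi y *
        \prod_(j : {j | j \in l} | j != i) nu (val j) l (y j)))) =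
      nu (val i) l a' * (\sum_(y : lconf l | y i == a') psi y *
        \prod_(j : {j | j \in l} | j != i) nu (val j) l (y j)).
    by rewrite /C; field; rewrite !gt_eqF ?edge_const_gt0.
  rewrite mulr_sumr; apply: eq_bigr => y /eqP <-.
  by rewrite /fbelief_unnorm (bigD1 i) //= mulrCA.
(* As [b] sums to 1, summing over the spin at [i] identifies [C] as the normalizer of the factor
   belief. *)
have fnE : fnorm l = C.
  rewrite /fnorm (partition_big (fun y : lconf l => y i) xpredT) //=.
  under eq_bigr do rewrite bE.
  by rewrite -mulr_sumr sum_vbelief mulr1.
rewrite -mulr_suml bE -/(fnorm l) fnE mulrC mulKf // -fnE.
by rewrite gt_eqF // fnorm_gt0.
Qed.

Lemma sum_fbelief_vertex (l : {set V}) (i : {i | i \in l}) (E : bool -> R) :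
  l \in F -> \sum_(y : lconf l) bf y * E (y i) = \sum_(a : bool) b (val i) a * E a.
Proof.
move=> lF; rewrite (partition_big (fun y : lconf l => y i) xpredT) //=.
apply: eq_bigr => a _; rewrite -(fbelief_marginal i a lF) mulr_suml.
by apply: eq_bigr => y /eqP ->.
Qed.

(** * Moments and the coefficients [beta] *)

Lemma vbelief_moment i n : \sum_(a : bool) b i a * t i a ^+ n =
  (-1) ^+ n * (fpoly R n).[gamma F mu i].
Proof.
under eq_bigr do rewrite vbelief_xi.
by rewrite tilt_moment_f ?xi_gt0 // gamma_xi.
Qed.

Lemma vbelief_spin_moment i n :
  (x i + (x i)^-1) * (\sum_(a : bool) (spin a)%:~R * b i a * t i a ^+ n) =
  (-1) ^+ n * (gpoly R n).[gamma F mu i].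
Proof.
rewrite gamma_xi -tilt_moment_g ?xi_gt0 // mulr_sumr; apply: eq_bigr => a _.
rewrite vbelief_xi; set D := x i + _; have D0 : 0 < D by apply: xiD_gt0.
by field; rewrite gt_eqF.
Qed.

(* The functionals [h |-> sum_a h a / (x + x^-1)] and
   [h |-> sum_a h a * tilt x a / (x + x^-1)] are dual to the basis
   [x ^ spin a, spin a] of the functions of one spin, which gives the formula
   for the coefficients. *)
Lemma is_beta_moments (l : {set V}) : l \in F ->
  is_beta F psi mu nu l [ffun I : {set V} => if I \subset l then
    \sum_(y : lconf l) bf y * \prod_(i in I) t i (extend y i) else 0].
Proof.
move=> lF; split=> [|I Il /eqP/cards1P[i Ii]|y|I Il]; last first.
- by rewrite ffunE (negPf Il).
- rewrite mulrC; apply: (canRL (mulfK _)).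
    by rewrite gt_eqF // prodr_gt0 // => i _; apply: xiD_gt0.
  (* By [tilt_orthogonal] the product vanishes unless [z = y]; expanding it over subsets of [l] then
     exhibits the coefficients. *)
  have -> : bf y * \prod_(i in l) (x i + (x i)^-1) =
      \sum_(z : lconf l) bf z * \prod_(i in l)
        ((spin (extend y i))%:~R * t i (extend z i) + x i ^ spin (extend y i)).
    rewrite (bigD1 y) //= [X in _ = _ + X]big1 ?addr0 => [|z zy].
      congr (_ * _); apply: eq_bigr => i _.
      by rewrite tilt_orthogonal ?eqxx ?xi_gt0.
    have [u zu] : exists u, z u != y u.
      by apply/existsP; rewrite -negb_forall; apply: contra zy => /forallP zy;
         apply/eqP/ffunP => u; apply/eqP.
    apply/eqP; rewrite mulf_eq0; apply/orP; right.
    rewrite (bigD1 (val u)) ?(valP u) //= !extendE tilt_orthogonal ?xi_gt0 //.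
    by rewrite [y u == _]eq_sym (negPf zu) mul0r.
  under eq_bigr do rewrite prodrD_subsets mulr_sumr.
  rewrite exchange_big /=; apply: eq_bigr => I Il.
  rewrite ffunE Il -mulrA mulr_suml; apply: eq_bigr => z _.
  rewrite -mulrA big_split /=; congr (_ * _).
  rewrite (prod_local_split (fun _ a => (spin a)%:~R) (fun i a => x i ^ spin a)
    Il (fun u => esym (extendE y u))).
  by rewrite [\prod_(i in I) _ * _ in LHS]mulrC -mulrA.
- have il : i \in l by apply: (fintype.subsetP Il); rewrite Ii set11.
  rewrite ffunE Il Ii.
  (* A singleton coefficient is a first moment, which vanishes because [f_1 = 0]. *)
  under eq_bigr do rewrite big_set1 (extendE _ (Sub i il : {i | i \in l})) -[t i _]expr1.
  rewrite (sum_fbelief_vertex _ (fun a => t i a ^+ 1) lF) vbelief_moment.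
  by rewrite horner0 mulr0.
- by rewrite ffunE finset.sub0set; under eq_bigr do rewrite big_set0 mulr1; apply: sum_fbelief.
Qed.

Lemma betaP (l : {set V}) : l \in F -> is_beta F psi mu nu l (beta F psi mu nu l).
Proof. by move=> lF; apply: xgetPex; eexists; apply: is_beta_moments lF. Qed.

(** The factor by which the belief at [l] deviates from the product of its vertex beliefs. *)
Let T (l : {set V}) (w : {ffun V -> bool}) : R :=
  \sum_(I : {set V} | I \subset l)
     beta F psi mu nu l I * \prod_(i in I) t i (w i).

Lemma fbelief_restrict (l : {set V}) w : l \in F ->
  bf (Defs.restrict l w) = \prod_(i in l) b i (w i) * T l w.
Proof.
move=> lF; have [_ _ -> _] := betaP lF.
under [in RHS]eq_bigr do rewrite vbelief_xi.
rewrite prodf_div [in RHS]mulrAC [RHS]mulrC; congr (_ * _).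
rewrite /T mulr_sumr; apply: eq_bigr => I Il.
rewrite -mulrA (prod_local_split (fun _ a => (spin a)%:~R)
  (fun i a => x i ^ spin a) (w := w) Il); last by move=> u; rewrite ffunE.
rewrite [RHS]mulrCA; congr (_ * _).
(* On [I] each spin is [x ^ spin] times its tilt, so the powers of [x i] complete to a product over
   all of [l]. *)
rewrite [in RHS](big_setID I) (finset.setIidPr Il) /= [RHS]mulrAC -big_split /=.
by congr (_ * _); apply: eq_bigr => i _; rewrite tilt_mul_exp // xi_gt0.
Qed.

(** * Reparametrization of the weight and the Bethe approximation *)

Let K i : R := vnorm i * \prod_(l in F | i \in l) edge_const i l.

Let K_gt0 i : 0 < K i.
Proof.
by rewrite mulr_gt0 // prodr_gt0 // => l /andP[lF il]; apply: edge_const_gt0.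
Qed.

(** Each quotient is [edge_const i l * mu l i a], and the messages into [i] multiply to
    [vnorm i * b i a]. *)
Let prod_vbelief_div i a :
  \prod_(l in F | i \in l) (b i a / nu i l a) = K i * b i a.
Proof.
transitivity (\prod_(l in F | i \in l) (edge_const i l * mu l i a)).
  apply: eq_bigr => l /andP[lF il]; rewrite {1}(vbelief_edge a lF il).
  by field; rewrite gt_eqF // nu_gt0.
rewrite big_split /= -/(vbelief_unnorm F mu i a) /K /vbelief -/(vnorm i).
by field; rewrite gt_eqF.
Qed.

Let psi_fbelief (l : {set V}) (y : lconf l) : l \in F ->
  psi y = fnorm l * bf y / \prod_(j : {j | j \in l}) nu (val j) l (y j).
Proof.
move=> lF; rewrite /fbelief -/(fnorm l) /fbelief_unnorm; field.
rewrite lt0r_neq0 ?(lt0r_neq0 (fnorm_gt0 lF)) //.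
by apply: prodr_gt0 => j _; rewrite nu_gt0 // (valP j).
Qed.

Let prod_edge_exchange (E : V -> {set V} -> R) :
  \prod_(l in F) \prod_(i in l) E i l = \prod_i \prod_(l in F | i \in l) E i l.
Proof. by rewrite (exchange_big_dep xpredT). Qed.

Lemma weight_fbelief w : weight F psi w =
  \prod_(l in F) fnorm l * \prod_i K i
  * (\prod_i b i (w i) * \prod_(l in F) T l w).
Proof.
transitivity (\prod_(l in F)
    (fnorm l * \prod_(i in l) (b i (w i) / nu i l (w i)) * T l w)).
  apply: eq_bigr => l lF; rewrite psi_fbelief // fbelief_restrict //.
  rewrite [in RHS]prodf_div [in RHS](big_sub l (fun i => nu i l (w i))) /=.
  rewrite [X in _ / X = _](eq_bigr (fun j => nu (val j) l (w (val j)))); last first.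
    by move=> j _; rewrite ffunE.
  by ring.
rewrite [in LHS]big_split [in LHS]big_split /= prod_edge_exchange.
under [X in _ * X * _]eq_bigr do rewrite prod_vbelief_div.
by rewrite [in LHS]big_split /= !mulrA.
Qed.

Let sum_vertex_factor i : \sum_(a : bool) b i a * ln (K i) = ln (K i).
Proof. by rewrite -mulr_suml sum_vbelief mul1r. Qed.

(** At a factor, [ln psi - ln b_l] is [ln (fnorm l)] minus the logarithms of the incoming [nu],
    whose averages depend only on vertex beliefs by local consistency. Regrouped by vertex, these
    and the [degree i - 1] copies of [ln b_i] combine to [ln (K i)]. *)
Lemma betheE : bethe F psi mu nu = \prod_(l in F) fnorm l * \prod_i K i.
Proof.
have P1 : 0 < \prod_(l in F) fnorm l by apply: prodr_gt0 => l; apply: fnorm_gt0.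
have P2 : 0 < \prod_i K i by apply: prodr_gt0 => i _; apply: K_gt0.
rewrite /bethe -[RHS]lnK ?posrE ?mulr_gt0 //; congr expR.
rewrite lnM ?posrE // !ln_prod //.
have lE (l : {set V}) : l \in F ->
    \sum_(y : lconf l) bf y * ln (psi y) - \sum_(y : lconf l) bf y * ln (bf y) =
    ln (fnorm l) - \sum_(i in l) \sum_(a : bool) b i a * ln (nu i l a).
  move=> lF; rewrite -sumrB.
  rewrite (big_sub l (fun i => \sum_(a : bool) b i a * ln (nu i l a))) /=.
  under [in RHS]eq_bigr => j _ do
    rewrite -(sum_fbelief_vertex j (fun a => ln (nu (val j) l a)) lF).
  rewrite exchange_big /= -[ln (fnorm l)]mul1r -(sum_fbelief lF) mulr_suml -sumrB.
  apply: eq_bigr => y _; rewrite -mulr_sumr -!mulrBr; congr (_ * _).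
  have nu0 (j : {j | j \in l}) : 0 < nu (val j) l (y j) by rewrite nu_gt0 // (valP j).
  have fb := fbelief_gt0 y lF; have fn := fnorm_gt0 lF; have fnb := mulr_gt0 fn fb.
  have Nu : 0 < \prod_(j : {j | j \in l}) nu (val j) l (y j) by apply: prodr_gt0.
  rewrite psi_fbelief // [ln (fnorm l * _ / _)]ln_div ?posrE //.
  rewrite [ln (fnorm l * _)]lnM ?posrE // ln_prod //; ring.
rewrite /log_bethe -sumrB (eq_bigr _ lE) sumrB -addrA; congr (_ + _).
rewrite (exchange_big_dep xpredT) //= addrC -sumrB; apply: eq_bigr => i _.
(* The constant [ln (K i)] is written as an average under [b i], so that the two sides can be
   compared spin by spin. *)
rewrite exchange_big /= mulr_sumr -sumrB -[RHS]sum_vertex_factor.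
apply: eq_bigr => a _; rewrite -mulr_sumr mulrCA -mulrBr; congr (_ * _).
have b0 := vbelief_gt0 i a.
have -> : ln (K i) = ln (K i * b i a) - ln (b i a).
  by rewrite lnM ?posrE // addrK.
rewrite -prod_vbelief_div ln_prod; last first.
  by move=> l /andP[lF il]; apply: divr_gt0 => //; apply: nu_gt0.
rewrite [in RHS](eq_bigr (fun l => ln (b i a) - ln (nu i l a))); last first.
  by move=> l /andP[lF il]; apply: ln_div; rewrite posrE // nu_gt0.
rewrite sumrB sumr_const.
have -> : #|[pred l | (l \in F) && (i \in l)]| = degree F i.
  by apply: eq_card => l; rewrite !inE.
by rewrite -mulr_natl; ring.
Qed.

Lemma bethe_gt0 : 0 < bethe F psi mu nu.
Proof. exact: expR_gt0. Qed.

Lemma weight_bethe w : weight F psi w =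
  bethe F psi mu nu * (\prod_i b i (w i) * \prod_(l in F) T l w).
Proof. by rewrite betheE weight_fbelief. Qed.

(** * The loop series for the marginal *)

Lemma partition_function_gt0 : 0 < partition_function F psi.
Proof.
have weight_gt0 w : 0 < weight F psi w.
  by apply: prodr_gt0 => l lF; apply: psi_gt0.
rewrite /partition_function (bigD1 [ffun=> false]) //= ltr_pwDl //.
by apply: sumr_ge0 => w _; rewrite ltW.
Qed.

Lemma marginal_diff v :
  partition_function F psi * (marginal F psi v true - marginal F psi v false) =
  \sum_(w : {ffun V -> bool}) (spin (w v))%:~R * weight F psi w.
Proof.
have mE a : partition_function F psi * marginal F psi v a =
    \sum_(w : {ffun V -> bool} | w v == a) weight F psi w.
  rewrite mulr_sumr; apply: eq_bigr => w _.
  by rewrite /prob mulrC divfK // gt_eqF // partition_function_gt0.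
rewrite mulrBr !mE [RHS](partition_big (fun w : {ffun V -> bool} => w v) xpredT) //=.
rewrite big_bool -sumrN; congr (_ + _); apply: eq_bigr => w /eqP -> /=.
  by rewrite mul1r.
by rewrite mulN1r.
Qed.

Let prod_T w : \prod_(l in F) T l w =
  \sum_(s : {set V * {set V}} | s \subset edges F)
     \prod_(l in F) beta F psi mu nu l (sub_factor s l)
     * \prod_i t i (w i) ^+ sub_degree s i.
Proof.
rewrite (prod_sum_subsets F (fun l I => beta F psi mu nu l I *
  \prod_(i in I) t i (w i))); apply: eq_bigr => s sE.
by rewrite big_split /= (prod_sub_factor (fun i => t i (w i)) sE).
Qed.

(** The summand is a product over vertices, so the sum over [w] factors into one-vertex moments;
    only the one at [v] carries a spin and takes the factor [x v + (x v)^-1]. *)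
Lemma sum_spin_moments v (d : V -> nat) :
  (x v + (x v)^-1) * (\sum_(w : {ffun V -> bool})
    (spin (w v))%:~R * \prod_i (b i (w i) * t i (w i) ^+ d i)) =
  (-1) ^+ (\sum_i d i)%N * (\prod_(i | i != v) (fpoly R (d i)).[gamma F mu i]
  * (gpoly R (d v)).[gamma F mu v]).
Proof.
pose E i a : R := (if i == v then (spin a)%:~R else 1) * b i a * t i a ^+ d i.
have -> : \sum_(w : {ffun V -> bool})
    (spin (w v))%:~R * \prod_i (b i (w i) * t i (w i) ^+ d i) =
    \prod_i \sum_(a : bool) E i a.
  rewrite bigA_distr_bigA; apply: eq_bigr => w _.
  rewrite (bigD1 v) //= [RHS](bigD1 v) //= /E eqxx !mulrA; congr (_ * _).
  by apply: eq_bigr => i /negPf ->; rewrite mul1r.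
rewrite (bigD1 v) //= mulrA.
have -> : \sum_(a : bool) E v a =
    \sum_(a : bool) (spin a)%:~R * b v a * t v a ^+ d v.
  by apply: eq_bigr => a _; rewrite /E eqxx.
rewrite vbelief_spin_moment.
have -> : \prod_(i | i != v) \sum_(a : bool) E i a =
    \prod_(i | i != v) (-1) ^+ d i
    * \prod_(i | i != v) (fpoly R (d i)).[gamma F mu i].
  rewrite -big_split; apply: eq_bigr => i iv /=; rewrite -vbelief_moment.
  by apply: eq_bigr => a _; rewrite /E (negPf iv) mul1r.
by rewrite [in RHS]expr_sum (bigD1 v (P := xpredT)) //=; ring.
Qed.

Lemma marginal_loop_series v :
  partition_function F psi / bethe F psi mu nu
  * ((marginal F psi v true - marginal F psi v false)
     / Num.sqrt (b v true * b v false))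
  = \sum_(s : {set V * {set V}} | s \subset edges F)
      (-1) ^+ #|s|
      * \prod_(l in F) beta F psi mu nu l (sub_factor s l)
      * \prod_(i | i != v) (fpoly R (sub_degree s i)).[gamma F mu i]
      * (gpoly R (sub_degree s v)).[gamma F mu v].
Proof.
rewrite sqrt_vbelief invrK mulrACA mulrA marginal_diff.
under eq_bigr do rewrite weight_bethe mulrCA prod_T.
rewrite -mulr_sumr [bethe _ _ _ _ * _]mulrC mulfK ?lt0r_neq0 ?bethe_gt0 // mulrC.
under eq_bigr do rewrite mulr_sumr mulr_sumr.
rewrite exchange_big mulr_sumr; apply: eq_bigr => s _ /=.
(* Each edge has one endpoint in [V], so the vertex signs multiply to [(-1) ^+ #|s|]. *)
rewrite -sum_sub_degree -!mulrA [RHS]mulrCA -sum_spin_moments [RHS]mulrCA.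
congr (_ * _); rewrite mulr_sumr; apply: eq_bigr => w _.
by rewrite [in RHS]big_split /=; ring.
Qed.

End FixedPoint.

Theorem theorem6 (R : realType) (N : nat) (F : {set {set 'I_N.+1}})
  (psi : forall l : {set 'I_N.+1}, lconf l -> R)
  (mu : {set 'I_N.+1} -> 'I_N.+1 -> bool -> R)
  (nu : 'I_N.+1 -> {set 'I_N.+1} -> bool -> R)
  (F_nonempty : forall l : {set 'I_N.+1}, l \in F -> l != finset.set0)
  (psi_gt0 : forall l : {set 'I_N.+1}, l \in F ->
     forall y : lconf l, 0 < psi l y)
  (fixed_pt : lbp_fixed_point F psi mu nu) :
  partition_function F psi / bethe F psi mu nu
  * ((marginal F psi ord0 true - marginal F psi ord0 false)
     / Num.sqrt (vbelief F mu ord0 true * vbelief F mu ord0 false))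
  = \sum_(s : {set 'I_N.+1 * {set 'I_N.+1}} | s \subset edges F)
      (-1) ^+ #|s|
      * \prod_(l in F) beta F psi mu nu l (sub_factor s l)
      * \prod_(i : 'I_N.+1 | i != ord0)
          (fpoly R (sub_degree s i)).[gamma F mu i]
      * (gpoly R (sub_degree s ord0)).[gamma F mu ord0].
Proof. exact: marginal_loop_series. Qed.
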